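(* In the Sum of Squares Clustering problem on networks with a single cluster, the optimal cluster center may be located at an interior point of an edge. That is, there exist a network $\mathbf{G}=(\mathbf{E},\mathbf{V})$ with vertices $v_1,\dots,v_N$ and weights $h_1,\dots,h_N>0$ such that the problem of minimizing $$f(x)=\sum_{i=1}^N h_i\,d(v_i,x)^2$$ over all points $x\in\mathbf{G}$ has an optimal solution that is an interior point of an edge.
   Context: A network $\mathbf{G}=(\mathbf{E},\mathbf{V})$ is a finite, undirected, connected graph with vertex set $\mathbf{V}=\{v_1,\dots,v_N\}$ and edge set $\mathbf{E}$, in which each edge $e$ has a strictly positive length. Each edge is identified with a segment of its length, so that ''points of $\mathbf{G}$'' means vertices as well as interior points of edges, and $d(\cdot,\cdot)$ is the shortest path distance between points of $\mathbf{G}$. *)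

(* Defs.v *)
From HB Require Import structures.
From mathcomp Require Import all_boot all_order all_algebra.
From mathcomp Require Import classical_sets reals.

Set Implicit Arguments.
Unset Strict Implicit.
Unset Printing Implicit Defensive.

Import Order.TTheory GRing.Theory Num.Theory.

Local Open Scope classical_set_scope.
Local Open Scope ring_scope.

Record network (R : realType) := Network {
  nvertices : nat;
  nvertices_gt0 : (0 < nvertices)%N;
  adj : rel 'I_nvertices;
  adj_sym : symmetric adj;
  adj_irrefl : irreflexive adj;
  adj_connected : forall u v : 'I_nvertices, connect adj u v;
  len : 'I_nvertices -> 'I_nvertices -> R;
  len_sym : forall u v : 'I_nvertices, len u v = len v u;
  len_gt0 : forall u v : 'I_nvertices, adj u v -> 0 < len u v
}.

(* An undirected edge is stored once, through its endpoints in increasing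
   order, so that the offset of a point from [src] is well defined. *)
Record netedge (R : realType) (G : network R) := Edge {
  src : 'I_(nvertices G);
  dst : 'I_(nvertices G);
  src_lt_dst : (src < dst)%N;
  src_adj_dst : adj src dst
}.

Definition edge_len (R : realType) (G : network R) (e : netedge G) : R :=
  len (src e) (dst e).

Inductive netpoint (R : realType) (G : network R) :=
| Vertex (v : 'I_(nvertices G))
| Inner (e : netedge G) (t : R) (ht : 0 < t < edge_len e).

(* [at_offset e x s]: on the closed edge [e], identified with the segment
   [0, edge_len e], the point [x] has coordinate [s]. *)
Inductive at_offset (R : realType) (G : network R) (e : netedge G) :
    netpoint G -> R -> Prop :=
| at_src : at_offset e (Vertex (src e)) 0
| at_dst : at_offset e (Vertex (dst e)) (edge_len e)
| at_inner (t : R) (ht : 0 < t < edge_len e) : at_offset e (Inner ht) t.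

(* [route x y l]: some path of length [l] goes from [x] to [y]; a path is a
   finite succession of segments, each contained in a closed edge. *)
Inductive route (R : realType) (G : network R) :
    netpoint G -> netpoint G -> R -> Prop :=
| route_nil (x : netpoint G) : route x x 0
| route_cons (e : netedge G) (x y z : netpoint G) (s t l : R) :
    at_offset e x s -> at_offset e y t -> route y z l ->
    route x z (`|s - t| + l).

(* Finitely many edges of positive length: the infimum is attained, by a
   shortest path. *)
Definition netdist (R : realType) (G : network R) (x y : netpoint G) : R :=
  inf [set l | route x y l].

Definition ssq_cost (R : realType) (G : network R) (h : 'I_(nvertices G) -> R)
    (x : netpoint G) : R :=
  \sum_i h i * netdist (Vertex i) x ^+ 2.

Definition interior_point (R : realType) (G : network R) (x : netpoint G) : Prop :=
  exists (e : netedge G) (t : R) (ht : 0 < t < edge_len e), x = Inner ht.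

(* Main.v *)
(* On a single edge of length 2 with unit weights at both ends, the point at
   offset s has cost s^2 + (2 - s)^2 = 2 + 2 (s - 1)^2, which is least at the
   midpoint. *)

Require Import Defs.
From mathcomp Require Import all_boot all_order all_algebra.
From mathcomp Require Import classical_sets reals.
From mathcomp Require Import lra.

Set Implicit Arguments.
Unset Strict Implicit.
Unset Printing Implicit Defensive.

Import Order.TTheory GRing.Theory Num.Theory.

Local Open Scope ring_scope.

(** The network is a single edge of length 2, and [segment_coord] identifies it with the interval
    from 0 to 2. Distances from a vertex agree with those on the real line ([netdist_vertex]): no
    route is shorter than the coordinate gap, by [route_coord_le], and one straight segment attains
    it. The cost is thus a quadratic in the coordinate, minimal at 1, strictly inside the edge. *)

Definition distinct : rel 'I_2 := fun u v => u != v.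

Lemma distinct_sym : symmetric distinct.
Proof. by move=> u v; rewrite /distinct eq_sym. Qed.

Lemma distinct_irrefl : irreflexive distinct.
Proof. by move=> u; rewrite /distinct eqxx. Qed.

Lemma distinct_connected (u v : 'I_2) : connect distinct u v.
Proof. by have [->|uv] := eqVneq u v; [exact: connect0 | exact: connect1]. Qed.

Definition segment (R : realType) : network R :=
  @Network R 2 isT distinct distinct_sym distinct_irrefl distinct_connected
    (fun _ _ => 2) (fun _ _ => erefl) (fun _ _ _ => ltr0n R 2).

Definition segment_edge (R : realType) : netedge (segment R) :=
  @Edge R (segment R) ord0 (lift ord0 ord0) isT isT.

Definition segment_coord (R : realType) (x : netpoint (segment R)) : R :=
  match x with
  | Vertex v => 2 * v%:R
  | Inner _ t _ => t
  end.

(** Among two vertices, increasing order of endpoints leaves only one choice, so every [e] has the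
    same ends. *)
Lemma segment_src (R : realType) (e : netedge (segment R)) :
  src e = 0%N :> nat.
Proof. by case: e => [[[|[|m]] ?] [[|[|k]] ?]]. Qed.

Lemma segment_dst (R : realType) (e : netedge (segment R)) :
  dst e = 1%N :> nat.
Proof. by case: e => [[[|[|m]] ?] [[|[|k]] ?]]. Qed.

Lemma at_offset_coord (R : realType) (e : netedge (segment R)) x s :
  at_offset e x s -> s = segment_coord x.
Proof.
by case=> //=; rewrite ?segment_src ?segment_dst ?mulr0 ?mulr1.
Qed.

(** Stated for arbitrary [e] because an inner point carries its own edge record, and a one-segment
    route must locate both of its ends on the same one. *)
Lemma at_offset_vertex (R : realType) (e : netedge (segment R)) (v : 'I_2) :
  at_offset e (Vertex (G := segment R) v) (2 * v%:R).
Proof.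
case: v => [[|[|//]] v2] /=; rewrite ?mulr0 ?mulr1.
- by rewrite (_ : Ordinal v2 = src e);
    [exact: at_src | apply/val_inj; rewrite /= segment_src].
- by rewrite (_ : Ordinal v2 = dst e);
    [exact: at_dst | apply/val_inj; rewrite /= segment_dst].
Qed.

Lemma at_offset_exists (R : realType) (x : netpoint (segment R)) :
  exists e, at_offset e x (segment_coord x).
Proof.
case: x => [v|e t ht]; last by exists e; exact: at_inner.
by exists (segment_edge R); exact: at_offset_vertex.
Qed.

(** Offsets are global coordinates here, so the triangle inequality on the line telescopes along the
    route. *)
Lemma route_coord_le (R : realType) (x y : netpoint (segment R)) l :
  route x y l -> `|segment_coord x - segment_coord y| <= l.
Proof.
elim=> [z|e a b c s t k /at_offset_coord-> /at_offset_coord-> _ IH].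
  by rewrite subrr normr0.
by rewrite (le_trans (ler_distD (segment_coord b) _ _))// lerD2l.
Qed.

Lemma netdist_vertex (R : realType) (v : 'I_2) (x : netpoint (segment R)) :
  netdist (Vertex (G := segment R) v) x = `|2 * v%:R - segment_coord x|.
Proof.
have [e ex] := at_offset_exists x.
have vx : route (Vertex (G := segment R) v) x `|2 * v%:R - segment_coord x|.
  rewrite -[X in route _ _ X]addr0.
  by apply: route_cons ex (route_nil _); exact: at_offset_vertex.
apply/le_anti/andP; split.
- apply: ge_inf => //.
  (* The infimum is at most the length of the route [vx] once the lengths are known to be bounded
     below; the coordinate gap is such a bound. *)
  by exists `|2 * v%:R - segment_coord x| => l /= /route_coord_le.
- by apply: lb_le_inf; [exists `|2 * v%:R - segment_coord x|
                       | move=> l /= /route_coord_le].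
Qed.

Lemma ssq_cost_segment (R : realType) (x : netpoint (segment R)) :
  ssq_cost (fun=> 1) x = segment_coord x ^+ 2 + (2 - segment_coord x) ^+ 2.
Proof.
rewrite /ssq_cost big_ord_recl big_ord1 !netdist_vertex !mul1r !real_normK ?num_real//.
by rewrite mulr0 mulr1 sub0r sqrrN.
Qed.

Theorem theorem4p1 (R : realType) :
  exists (G : network R) (h : 'I_(nvertices G) -> R),
    (forall i : 'I_(nvertices G), 0 < h i) /\
    exists x : netpoint G,
      interior_point x /\
      (forall y : netpoint G, ssq_cost h x <= ssq_cost h y).
Proof.
have mid : 0 < (1 : R) < edge_len (segment_edge R).
  by rewrite /edge_len /= ltr01 ltr1n.
exists (segment R), (fun=> 1); split=> [_|]; first exact: ltr01.
exists (Inner mid); split=> [|y]; first by exists (segment_edge R), 1, mid.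
(* The cost at [y] exceeds the midpoint's cost 2 by exactly twice this square. *)
rewrite !ssq_cost_segment /=; have := sqr_ge0 (segment_coord y - 1); nra.
Qed.
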